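(* Let $\alpha$ be a constant with $0.579\leq\alpha\leq 1$ and let $\beta>(2\alpha-1)/4$. Then there exists $n_0$ such that every graph $G$ on $n\geq n_0$ vertices in which every subset of $\lfloor\alpha n\rfloor$ vertices spans at least $\beta n^2$ edges contains a triangle.
   Context: A set $S\subseteq V(G)$ spans the edges of $G$ with both endpoints in $S$. *)

(* Defs.v *)
From HB Require Import structures.
From mathcomp Require Import all_boot all_order all_algebra.
From mathcomp Require Import reals.

Set Implicit Arguments.
Unset Strict Implicit.
Unset Printing Implicit Defensive.

Import Order.TTheory GRing.Theory Num.Theory.

Section Graph.
Variables (T : finType) (e : rel T).

(* [e] is the adjacency relation of a simple graph with vertex set [T]. *)
Definition simple_graph : Prop := symmetric e /\ irreflexive e.

(* Edges are unordered pairs, so each edge is counted once in [#|edges|]. *)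
Definition edges : {set {set T}} :=
  [set [set p.1; p.2] | p : T * T & e p.1 p.2].

Definition spanned_edges (S : {set T}) : {set {set T}} :=
  [set E in edges | E \subset S].

(* In a simple graph, irreflexivity makes the three vertices distinct. *)
Definition has_triangle : Prop :=
  exists x y z : T, [/\ e x y, e y z & e x z].

End Graph.

(* Main.v *)
(* Sets are replaced by weights w : V -> [0, 1], and 2 e(S) by the quadratic form
   Q(w) = sum_(x, y) e(x, y) w(x) w(y).  As Q is concave along the directions
   delta_x - delta_y, a weight of integral total k can be rounded to a set of size
   k.  Interpolating with the constant weight 1, for which Q(1) <= n^2 / 2 by
   Mantel, reduces the claim to alpha = 0.579, where (2 alpha - 1) / 2 = 0.079 and
   1 - alpha = 0.421.

   Let u have maximum degree a.  If a >= n/2, the weight 1 on N(u), completed by a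
   constant off N(u), is sparse.  If a <= n/2 and an edge uv has both degrees at
   least 0.421 n, then the weight 1 off N(u), completed by a constant on N(u), or
   the same weight for v, is sparse.  If a >= 0.421 n but there is no such edge,
   then one of the weights is sparse that are 1 on N(u), 0 on N(v) and constant on
   the rest, with v in N(u).  If all degrees are at most 0.421 n, one averages Q of
   these weights over all ordered edges uv.  The resulting inequality between
   densities of graphs on six vertices is refuted by a flag algebra certificate,
   i.e. a sum of squares, which is verified by computing with the 5789 labelled
   triangle-free graphs on six vertices. *)
From Stdlib Require Import ZArith.
Require Import Defs.
From HB Require Import structures.
From mathcomp Require Import all_boot all_order all_algebra.
From mathcomp Require Import reals.
From mathcomp Require Import ssrZ ring lra.

Set Implicit Arguments.
Unset Strict Implicit.
Unset Printing Implicit Defensive.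

Import Order.TTheory GRing.Theory Num.Theory.
Local Open Scope ring_scope.
(* The key %Z is bound to int_scope. *)
Delimit Scope Z_scope with BZ.

(** * The certificate *)

(* A graph on the vertices 0, ..., 5 is coded by the list of its adjacencies
   01, 02, 12, 03, 13, 23, 04, 14, 24, 34, 05, 15, 25, 35, 45. *)
Definition relabel (p : seq nat) (c : seq bool) : seq bool :=
  [seq nth false c i | i <- p].

(** Permutations of the 15 positions induced by exchanging the vertices i and i+1, for i = 0, ...,
    4. *)
Definition adjacent_swaps : seq (seq nat) := [::
  [:: 0; 2; 1; 4; 3; 5; 7; 6; 8; 9; 11; 10; 12; 13; 14];
  [:: 1; 0; 2; 3; 5; 4; 6; 8; 7; 9; 10; 12; 11; 13; 14];
  [:: 0; 3; 4; 1; 2; 5; 6; 7; 9; 8; 10; 11; 13; 12; 14];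
  [:: 0; 1; 2; 6; 7; 8; 3; 4; 5; 9; 10; 11; 12; 14; 13];
  [:: 0; 1; 2; 3; 4; 5; 10; 11; 12; 13; 6; 7; 8; 9; 14]]%N.

Definition triangle_positions : seq (seq nat) := [::
  [:: 0; 1; 2]; [:: 0; 3; 4]; [:: 1; 3; 5]; [:: 2; 4; 5];
  [:: 0; 6; 7]; [:: 1; 6; 8]; [:: 2; 7; 8]; [:: 3; 6; 9];
  [:: 4; 7; 9]; [:: 5; 8; 9]; [:: 0; 10; 11]; [:: 1; 10; 12];
  [:: 2; 11; 12]; [:: 3; 10; 13]; [:: 4; 11; 13]; [:: 5; 12; 13];
  [:: 6; 10; 14]; [:: 7; 11; 14]; [:: 8; 12; 14]; [:: 9; 13; 14]]%N.

(** The default [false] lets the test run on prefixes of codes, where adjacencies not yet chosen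
    count as absent. *)
Definition code_triangle (c : seq bool) : bool :=
  has (all (nth false c)) triangle_positions.

(** A trie over codes that branches on the adjacencies in order. [Void] cuts off prefixes that
    already contain a triangle, so that 5789 leaves remain instead of 2^15. *)
Inductive table := Void | Leaf of Z | Node of table & table.

Fixpoint tabulate (f : seq bool -> Z) (n : nat) (c : seq bool) : table :=
  if code_triangle c then Void else
  if n is m.+1 then
    Node (tabulate f m (rcons c false)) (tabulate f m (rcons c true))
  else Leaf (f c).

Fixpoint lookup (t : table) (c : seq bool) : option Z :=
  match t, c with
  | Leaf z, [::] => Some z
  | Node l r, b :: c' => lookup (if b then r else l) c'
  | _, _ => None
  end.

Fixpoint update (f : seq bool -> Z -> Z) (t : table) (c : seq bool) : table :=
  match t with
  | Void => Void
  | Leaf z => Leaf (f c z)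
  | Node l r => Node (update f l (rcons c false)) (update f r (rcons c true))
  end.

Definition add_relabelled (t : table) (r : table) (p : seq nat) : table :=
  update (fun c z => (z + odflt 0%BZ (lookup r (relabel p c)))%BZ) t [::].

(* By a Horner scheme, [symmetrise_step k t] sums [t] over the coset
   representatives s_i s_(i+1) ... s_(k-1), i <= k, of S_k in S_(k+1), where
   s_i exchanges the vertices i and i+1. *)
Definition symmetrise_step (k : nat) (t : table) : table :=
  foldl (add_relabelled t) t (take k adjacent_swaps).

Definition symmetrise (t : table) : table :=
  foldl (fun t k => symmetrise_step k t) t [:: 5; 4; 3; 2; 1]%N.

Fixpoint all_negative (t : table) : bool :=
  match t with
  | Void => true
  | Leaf z => (z <? 0)%BZ
  | Node l r => if all_negative l then all_negative r else false
  end.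

(* The rows of the three tables are indexed by flags (read as binary numbers);
   their columns are the vectors v of the squares (sum_F v_F F)^2.  They are
   rounded from a numerical solution of a semidefinite program.  Flags that
   contain a triangle have an empty row. *)
Definition nonedge_squares : seq (seq Z) := [::
    [:: 20; 0; 19; -27]; [:: 376; 13690; 517; 894];
    [:: 376; -13690; 517; 894]; [:: -3990; 0; -6860; -1164];
    [:: 376; 13690; 517; 894]; [:: -13832; -12746; -1781; 2243];
    [:: 33556; 0; -4115; 971]; [:: -3389; 3052; -78; -3887];
    [:: 376; -13690; 517; 894]; [:: 33556; 0; -4115; 971];
    [:: -13832; 12746; -1781; 2243]; [:: -3389; -3052; -78; -3887];
    [:: -3990; 0; -6860; -1164]; [:: -3389; 3052; -78; -3887];
    [:: -3389; -3052; -78; -3887]; [:: 5992; 0; 5421; -1084];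
    [:: 5230; 0; 9448; 1457]; [:: 1615; 9168; 2360; -689];
    [:: 1615; -9168; 2360; -689]; [:: -1308; 0; -1161; 1263];
    [:: 1615; 9168; 2360; -689]; [::];
    [:: 5000; 0; -6106; 116]; [::];
    [:: 1615; -9168; 2360; -689]; [:: 5000; 0; -6106; 116];
    [::]; [::];
    [:: -1308; 0; -1161; 1263]; [::];
    [::]; [::]]%BZ.

Definition edge_squares : seq (seq Z) := [::
    [:: -13268; 0; -11670; -2825]; [:: -1614; -16194; 1286; 3853];
    [:: -1614; 16194; 1286; 3853]; [::];
    [:: -1614; -16194; 1286; 3853]; [:: 46; 3968; 923; -3434];
    [:: 30223; 0; -2885; -1648]; [::];
    [:: -1614; 16194; 1286; 3853]; [:: 30223; 0; -2885; -1648];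
    [:: 46; -3968; 923; -3434]; [::];
    [::]; [::];
    [::]; [::];
    [:: 2863; 0; -2513; 6204]; [:: -4416; -16762; 7002; -1380];
    [:: -4416; 16762; 7002; -1380]; [::];
    [:: -4416; -16762; 7002; -1380]; [::];
    [:: -2042; 0; -2668; 2385]; [::];
    [:: -4416; 16762; 7002; -1380]; [:: -2042; 0; -2668; 2385];
    [::]; [::];
    [::]; [::];
    [::]; [::]]%BZ.

Definition edge_and_points_squares : seq (seq Z) := [::
    [:: 0; -8613; 0]; [:: -23004; -20135; 0];
    [:: 23004; -20135; 0]; [:: 0; 5572; 0];
    [:: 0; -3046; 2303]; [:: -21478; 11867; 11645];
    [:: 21478; 11867; 11645]; [:: 0; 12968; -13059];
    [:: 0; -3046; -2303]; [:: -21478; 11867; -11645];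
    [:: 21478; 11867; -11645]; [:: 0; 12968; 13059];
    [::]; [::];
    [::]; [::]]%BZ.

Definition flag_row (rows : seq (seq Z)) (flag : seq bool) : seq Z :=
  nth [::] rows (foldl (fun n (b : bool) => b + n.*2)%N 0%N flag).

(** The default 0 pads the rows with fewer than four entries. *)
Definition dot (u v : seq Z) : Z :=
  let t i := (nth 0 u i * nth 0 v i)%BZ in (t 0%N + t 1%N + t 2%N + t 3%N)%BZ.

Definition b2z (b : bool) : Z := if b then 1%BZ else 0%BZ.

Section Certificate.
Local Open Scope Z_scope.
Local Coercion b2z : bool >-> Z.
Variables a01 a02 a12 a03 a13 a23 a04 a14 a24 a34 a05 a15 a25 a35 a45 : bool.

(* Summed over the vertices 2, ..., 5, this is 10^6 times the excess
   Q(w) - 0.079 n^2 D^2 of the weight w = D 1_A + E 1_C at the ordered edge 01: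
   A = N(0), C is the set of common non-neighbours of 0 and 1, D = |C| and
   E = 0.579 n - |A|. *)
Definition neighbourhood_term : Z :=
  let C2 := 1 - a02 - a12 in
  let C3 := 1 - a03 - a13 in
  let C4 := 1 - a04 - a14 in
  let C5 := 1 - a05 - a15 in
  a01 * (2 * 1000 * (C4 * (579 - 1000 * a05) * (a02 * a23 * C3))
         + (579 - 1000 * a04) * (579 - 1000 * a05) * (C2 * a23 * C3)
         - 79 * 1000 * (C4 * C5)).

(* The excess 0.579^2 Q(w) - 0.079 |w|^2 of the indicator w of the complement of
   N(0), times n^3 plus 715 times the number of 3-stars with the leaf 0. *)
Definition complement_term : Z :=
  (1 + 715 * (a01 * a12 * a13)) *
  ((1 - a04) * (1 - a05) * (579 * 579 * a45 - 79 * 1000)).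

(** Cross term of two flags, on 0, 1, 2, 3 and on 0, 1, 4, 5, that share the labelled pair 01. *)
Definition pair_term : Z :=
  let rows := if a01 then edge_squares else nonedge_squares in
  dot (flag_row rows [:: a23; a02; a12; a03; a13])
      (flag_row rows [:: a45; a04; a14; a05; a15]).

(** The shared type is the edge 01 with two isolated vertices 2 and 3; each flag adds one vertex, 4
    or 5. *)
Definition quadruple_term : Z :=
  if a01 then if a02 || a12 || a03 || a13 || a23 then 0 else
    dot (flag_row edge_and_points_squares [:: a04; a14; a24; a34])
        (flag_row edge_and_points_squares [:: a05; a15; a25; a35])
  else 0.

Definition certificate_at : Z :=
  5 * 1000 * neighbourhood_term + complement_term + pair_term + quadruple_term.

End Certificate.

Definition certificate (c : seq bool) : Z :=
  if c is [:: a01; a02; a12; a03; a13; a23; a04; a14; a24; a34;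
              a05; a15; a25; a35; a45]
  then certificate_at a01 a02 a12 a03 a13 a23 a04 a14 a24 a34 a05 a15 a25 a35 a45
  else 0%BZ.

(** Single codes can have a positive value; it is the sum over the 720 relabellings that is
    negative. *)
Lemma certificate_negative :
  all_negative (symmetrise (tabulate certificate 15 [::])).
Proof. by vm_compute. Qed.

(** * Symmetrisation over the six vertices *)

Definition zr (R : realFieldType) (z : Z) : R := (int_of_Z z)%:~R.

Section ZR.
Variable R : realFieldType.
Local Notation zr := (zr R).

Lemma zrD x y : zr (x + y)%BZ = zr x + zr y.
Proof. by rewrite /zr -intrD; congr _%:~R; apply: (raddfD int_of_Z). Qed.

Lemma zrB x y : zr (x - y)%BZ = zr x - zr y.
Proof. by rewrite /zr -intrB; congr _%:~R; apply: (raddfB int_of_Z). Qed.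

Lemma zrM x y : zr (x * y)%BZ = zr x * zr y.
Proof. by rewrite /zr -intrM; congr _%:~R; apply: (rmorphM int_of_Z). Qed.

Lemma zr_nat n : zr (Z.of_nat n) = n%:R.
Proof. by rewrite /zr (Z_of_intK (Posz n)). Qed.

Lemma zr_bool (b : bool) : zr (b2z b) = b%:R.
Proof. by case: b. Qed.

Definition zrE := (zrD, zrB, zrM, zr_bool).

Lemma zr_numerals :
  ((zr 1 = 1) * (zr 2 = 2%:R) * (zr 5 = 5%:R) * (zr 79 = 79%:R) *
   (zr 579 = 579%:R) * (zr 715 = 715%:R) * (zr 1000 = 1000%:R))%type.
Proof.
by do !split; rewrite -zr_nat.
Qed.

Lemma zr_lt0 z : (z <? 0)%BZ -> zr z < 0.
Proof.
move=> /Z.ltb_lt z0; rewrite /zr ltrz0.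
by case: z z0 => //= p _; rewrite NegzE oppr_lt0.
Qed.

End ZR.

Section Symmetrisation.
Variables (R : realFieldType) (T : finType) (e : rel T).

(** Tuples with repeated vertices are included, so products of sums expand exactly and no
    lower-order error terms arise. *)
Definition sum6 (F : T -> T -> T -> T -> T -> T -> R) : R :=
  \sum_a \sum_b \sum_c \sum_d \sum_f \sum_g F a b c d f g.

Definition code (a b c d f g : T) : seq bool :=
  [:: e a b; e a c; e b c; e a d; e b d; e c d; e a f; e b f; e c f; e d f;
      e a g; e b g; e c g; e d g; e f g].

Definition code_sum (F : seq bool -> R) : R :=
  sum6 (fun a b c d f g => F (code a b c d f g)).

Lemma eq_sum6 F G : (forall a b c d f g, F a b c d f g = G a b c d f g) ->
  sum6 F = sum6 G.
Proof. by move=> FG; do 6![apply: eq_bigr => ? _]; apply: FG. Qed.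

Lemma sum6D F G :
  sum6 (fun a b c d f g => F a b c d f g + G a b c d f g) = sum6 F + sum6 G.
Proof.
rewrite /sum6 -big_split; apply: eq_bigr => a _.
rewrite -big_split; apply: eq_bigr => b _; rewrite -big_split; apply: eq_bigr => c _.
rewrite -big_split; apply: eq_bigr => d _; rewrite -big_split; apply: eq_bigr => f _.
by rewrite -big_split.
Qed.

Lemma sum6Z k F :
  sum6 (fun a b c d f g => k * F a b c d f g) = k * sum6 F.
Proof. by rewrite /sum6; do 6![rewrite mulr_sumr; apply: eq_bigr => ? _]. Qed.

Lemma sum6_lt0 F : (0 < #|T|)%N -> (forall a b c d f g, F a b c d f g < 0) ->
  sum6 F < 0.
Proof.
case/card_gt0P=> t _ F0.
have sum_neg (H : T -> R) : (forall x, H x < 0) -> \sum_x H x < 0.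
  move=> H0; have le0: \sum_(x | x != t) H x <= 0 by apply: sumr_le0 => x _; apply/ltW.
  by rewrite (bigD1 t) //=; have := H0 t; lra.
rewrite /sum6; do 6![apply: (sum_neg _) => ?]; exact: F0.
Qed.

Hypothesis e_sym : symmetric e.

(** Exchanging two consecutive summation variables permutes the code; only the adjacency between
    these two vertices comes out reversed, whence [e_sym]. *)
Lemma code_sum_relabel p F : p \in adjacent_swaps ->
  code_sum (fun c => F (relabel p c)) = code_sum F.
Proof.
rewrite !inE /code_sum => /or4P[|||/orP[]] /eqP->.
- rewrite [RHS]/sum6 exchange_big; apply: eq_sum6 => a b c d f g.
  by rewrite /relabel /code /= [e b a]e_sym.
- rewrite [RHS]/sum6; apply: eq_bigr => a _; rewrite exchange_big.
  by do 5![apply: eq_bigr => ? _]; rewrite /relabel /code /= [X in [:: _, _, X & _]]e_sym.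
- rewrite [RHS]/sum6; do 2![apply: eq_bigr => ? _]; rewrite exchange_big.
  by do 4![apply: eq_bigr => ? _]; rewrite /relabel /code /= [X in [:: _, _, _, _, _, X & _]]e_sym.
- rewrite [RHS]/sum6; do 3![apply: eq_bigr => ? _]; rewrite exchange_big.
  do 3![apply: eq_bigr => ? _]; rewrite /relabel /code /=.
  by rewrite [X in [:: _, _, _, _, _, _, _, _, _, X & _]]e_sym.
- rewrite [RHS]/sum6; do 4![apply: eq_bigr => ? _]; rewrite exchange_big.
  do 2![apply: eq_bigr => ? _]; rewrite /relabel /code /=.
  by rewrite [X in [:: _, _, _, _, _, _, _, _, _, _, _, _, _, _, X & _]]e_sym.
Qed.

Definition table_sum (t : table) : R :=
  code_sum (fun c => zr R (odflt 0%BZ (lookup t c))).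

(** Guarantees that the default 0 in [table_sum] is never taken. *)
Definition covers (t : table) : Prop :=
  forall a b c d f g, lookup t (code a b c d f g) != None.

Lemma lookup_update F t c c' : 
  lookup (update F t c) c' = omap (F (c ++ c')) (lookup t c').
Proof.
elim: t c c' => [|z|l IHl r IHr] c [|b c'] //=; first by rewrite cats0.
by case: b; rewrite ?IHl ?IHr cat_rcons.
Qed.

Lemma covers_add t r p : covers t -> covers (add_relabelled t r p).
Proof.
move=> tc a b c d f g; have := tc a b c d f g.
by rewrite lookup_update; case: lookup.
Qed.

Lemma table_sum_add t r p : covers t -> p \in adjacent_swaps ->
  table_sum (add_relabelled t r p) = table_sum t + table_sum r.
Proof.
move=> tc pP; rewrite -[table_sum r](code_sum_relabel _ pP) -sum6D.
apply: eq_sum6 => a b c d f g; have := tc a b c d f g.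
by rewrite lookup_update; case: lookup => //= z _; rewrite zrD.
Qed.

Lemma symmetrise_stepP k t : covers t ->
  covers (symmetrise_step k t) /\
  table_sum (symmetrise_step k t) = (size (take k adjacent_swaps)).+1%:R * table_sum t.
Proof.
move=> tc; rewrite /symmetrise_step.
have: {subset take k adjacent_swaps <= adjacent_swaps} by move=> p /mem_take.
elim/last_ind: (take k _) => [|ps p IH] psP; first by rewrite mul1r.
have [|rc rS] := IH; first by move=> q qP; apply: psP; rewrite mem_rcons inE qP orbT.
rewrite foldl_rcons size_rcons; split; first exact: covers_add.
rewrite table_sum_add ?rS //; last by apply: psP; rewrite mem_rcons mem_head.
by rewrite -[(size ps).+2]addn1 natrD mulrDl mul1r addrC.
Qed.

Lemma symmetriseP t : covers t ->
  covers (symmetrise t) /\ table_sum (symmetrise t) = 720%:R * table_sum t.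
Proof.
move=> tc; rewrite /symmetrise /=.
have [c5 s5] := symmetrise_stepP 5 tc.
have [c4 s4] := symmetrise_stepP 4 c5.
have [c3 s3] := symmetrise_stepP 3 c4.
have [c2 s2] := symmetrise_stepP 2 c3.
have [c1 s1] := symmetrise_stepP 1 c2.
by split=> //; rewrite s1 s2 s3 s4 s5 !mulrA -!natrM.
Qed.

Lemma lookup_negative t c : all_negative t -> lookup t c != None ->
  (odflt 0%BZ (lookup t c) <? 0)%BZ.
Proof.
elim: t c => [|z|l IHl r IHr] [|b c] //=.
by case: ifP => // ln rn; case: b; [apply: IHr | apply: IHl].
Qed.

Hypothesis e_tri : forall x y z, e x y -> e y z -> ~~ e x z.

Lemma lookup_tabulate F n c c' : size c' = n ->
  (forall k, ~~ code_triangle (c ++ take k c')) ->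
  lookup (tabulate F n c) c' = Some (F (c ++ c')).
Proof.
elim: n c c' => [|n IH] c [|b c'] //=; first by move=> _ /(_ 0%N); rewrite cats0 => /negPf->.
case=> sz tri; have := tri 0%N; rewrite cats0 => /negPf->.
have step : lookup (tabulate F n (rcons c b)) c' = Some (F (c ++ b :: c')).
  rewrite IH ?cat_rcons // => k.
  by have := tri k.+1; rewrite /= cat_rcons.
by case: b step {tri}.
Qed.

Lemma code_triangle_take k c : code_triangle (take k c) -> code_triangle c.
Proof.
move=> /hasP[p pP /allP all_p]; apply/hasP; exists p => //; apply/allP => i ip.
have := all_p i ip; case: (ltnP i k) => ik; first by rewrite nth_take.
by rewrite nth_default // size_take; case: ltnP => // /leq_trans->.
Qed.

Lemma code_triangle_free a b c d f g : ~~ code_triangle (code a b c d f g).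
Proof.
have tri x y z : ~~ (e x y && (e x z && (e y z && true))).
  by rewrite andbT; apply/negP => /and3P[xy xz yz]; have := e_tri xy yz; rewrite xz.
rewrite /code_triangle /triangle_positions -all_predC.
by rewrite /= !tri.
Qed.

Lemma lookup_tabulate_code F a b c d f g :
  lookup (tabulate F 15 [::]) (code a b c d f g) = Some (F (code a b c d f g)).
Proof.
apply: lookup_tabulate => // k; rewrite cat0s.
by apply: contra (code_triangle_free a b c d f g) => /code_triangle_take.
Qed.

Lemma certificate_sum_lt0 : (0 < #|T|)%N ->
  code_sum (fun c => zr R (certificate c)) < 0.
Proof.
move=> T0; set t := tabulate certificate 15 [::].
have tc : covers t by move=> *; rewrite lookup_tabulate_code.
have [sc sS] := symmetriseP tc.
have -> : code_sum (fun c => zr R (certificate c)) = table_sum t.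
  by apply: eq_sum6 => a b c d f g; rewrite lookup_tabulate_code.
have: table_sum (symmetrise t) < 0.
  apply: sum6_lt0 => // a b c d f g; apply: zr_lt0.
  exact: lookup_negative certificate_negative (sc _ _ _ _ _ _).
by rewrite sS pmulr_rlt0 ?ltr0n.
Qed.

End Symmetrisation.

(** * Graphs of small maximum degree *)

Section EdgeForm.
Variables (R : realFieldType) (T : finType) (e : rel T).

Definition adj (x y : T) : R := (e x y)%:R.
Definition deg (x : T) : R := \sum_y adj x y.
Definition edge_form (w w' : T -> R) : R := \sum_x \sum_y adj x y * (w x * w' y).
Definition weight (w : T -> R) : R := \sum_x w x.
(** For adjacent u and v in a triangle-free graph the neighbourhoods are disjoint, so this is the
    indicator of the common non-neighbours. *)
Definition off (u v x : T) : R := 1 - adj u x - adj v x.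

Local Notation N := (#|T|%:R : R).

(** The claim at alpha = 0.579, made homogeneous in w: scaled to total 0.579 N, a weight with values
    at most 1 has edge form above 0.079 N^2. *)
Definition locally_dense : Prop := forall w : T -> R,
  (forall x, 0 <= w x) ->
  (forall x, 579%:R * N * w x <= 1000%:R * weight w) ->
  0 < weight w ->
  79%:R * 1000%:R * weight w ^+ 2 < 579%:R * 579%:R * edge_form w w.

Lemma adj_ge0 x y : 0 <= adj x y.
Proof. exact: ler0n. Qed.

Lemma adj_le1 x y : adj x y <= 1.
Proof. by rewrite /adj lern1 leq_b1. Qed.

Lemma max_deg : (0 < #|T|)%N -> exists u, forall x, deg x <= deg u.
Proof.
case/card_gt0P=> t _; have [u _ umax] := arg_maxP deg (isT : xpredT t).
by exists u => x; apply: umax.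
Qed.

Lemma sum_const (c : R) : \sum_(x : T) c = c * N.
Proof. by rewrite sumr_const mulr_natr. Qed.

Lemma weightD w w' : weight (fun x => w x + w' x) = weight w + weight w'.
Proof. exact: big_split. Qed.

Lemma weightB w w' : weight (fun x => w x - w' x) = weight w - weight w'.
Proof. exact: sumrB. Qed.

Lemma weightZ k w : weight (fun x => k * w x) = k * weight w.
Proof. by rewrite /weight mulr_sumr. Qed.

Lemma edge_formDl w1 w2 w' :
  edge_form (fun x => w1 x + w2 x) w' = edge_form w1 w' + edge_form w2 w'.
Proof.
rewrite /edge_form -big_split; apply: eq_bigr => x _; rewrite -big_split.
by apply: eq_bigr => y _; rewrite mulrDl mulrDr.
Qed.

Lemma eq_edge_form w1 w2 : w1 =1 w2 -> edge_form w1 w1 = edge_form w2 w2.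
Proof. by move=> w12; apply: eq_bigr => x _; apply: eq_bigr => y _; rewrite !w12. Qed.

Lemma edge_formZl k w w' : edge_form (fun x => k * w x) w' = k * edge_form w w'.
Proof.
rewrite /edge_form mulr_sumr; apply: eq_bigr => x _; rewrite mulr_sumr.
by apply: eq_bigr => y _; ring.
Qed.

Lemma edge_form_ge0 w w' : (forall x, 0 <= w x) -> (forall x, 0 <= w' x) ->
  0 <= edge_form w w'.
Proof.
move=> w0 w'0; apply: sumr_ge0 => x _; apply: sumr_ge0 => y _.
by rewrite !mulr_ge0 ?adj_ge0.
Qed.

Local Notation sum4 F := (\sum_c \sum_d \sum_f \sum_g F c d f g).

Lemma sum4_prod (P : T -> T -> R) (X Y : T -> R) :
  sum4 (fun c d f g => P c d * (X f * Y g)) =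
  (\sum_c \sum_d P c d) * (weight X * weight Y).
Proof.
rewrite mulr_suml; apply: eq_bigr => c _; rewrite mulr_suml; apply: eq_bigr => d _.
rewrite /weight mulr_suml mulr_sumr; apply: eq_bigr => f _.
by rewrite mulr_sumr mulr_sumr.
Qed.

Lemma sum4D (F G : T -> T -> T -> T -> R) :
  sum4 (fun c d f g => F c d f g + G c d f g) = sum4 F + sum4 G.
Proof.
rewrite -big_split; apply: eq_bigr => c _; rewrite -big_split; apply: eq_bigr => d _.
by rewrite -big_split; apply: eq_bigr => f _; rewrite -big_split.
Qed.

Lemma sum4Z k (F : T -> T -> T -> T -> R) :
  sum4 (fun c d f g => k * F c d f g) = k * sum4 F.
Proof. by do 4![rewrite mulr_sumr; apply: eq_bigr => ? _]. Qed.

Lemma eq_sum4 (F G : T -> T -> T -> T -> R) :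
  (forall c d f g, F c d f g = G c d f g) -> sum4 F = sum4 G.
Proof. by move=> FG; do 4![apply: eq_bigr => ? _]; apply: FG. Qed.

Hypothesis e_sym : symmetric e.

Lemma adjC x y : adj x y = adj y x.
Proof. by rewrite /adj e_sym. Qed.

Lemma edge_formC w w' : edge_form w w' = edge_form w' w.
Proof.
rewrite /edge_form exchange_big; apply: eq_bigr => x _; apply: eq_bigr => y _.
by rewrite adjC; ring.
Qed.

Lemma edge_form_lin p q w w' :
  edge_form (fun x => p * w x + q * w' x) (fun x => p * w x + q * w' x) =
  p ^+ 2 * edge_form w w + 2%:R * p * q * edge_form w w' +
  q ^+ 2 * edge_form w' w'.
Proof.
set v := (fun x => p * w x + q * w' x); rewrite {1}/v edge_formDl !edge_formZl.
rewrite (edge_formC w v) (edge_formC w' v) /v !edge_formDl !edge_formZl.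
by rewrite (edge_formC w' w); ring.
Qed.

Lemma edge_formBl w1 w2 w' :
  edge_form (fun x => w1 x - w2 x) w' = edge_form w1 w' - edge_form w2 w'.
Proof.
rewrite edge_formDl; congr (_ + _); rewrite -mulN1r -edge_formZl.
by apply: eq_bigr => x _; apply: eq_bigr => y _; rewrite mulN1r.
Qed.

Lemma edge_form_1r w : edge_form w (fun=> 1) = \sum_x w x * deg x.
Proof.
rewrite /edge_form; apply: eq_bigr => x _; rewrite mulr_sumr.
by apply: eq_bigr => y _; ring.
Qed.

Hypothesis e_tri : forall x y z, e x y -> e y z -> ~~ e x z.

Lemma adj_tri x y z : adj x y * (adj x z * adj y z) = 0.
Proof.
rewrite /adj; case xy: (e x y); last by rewrite mul0r.
case yz: (e y z); last by rewrite !mulr0.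
by rewrite (negPf (e_tri xy yz)) mul0r mulr0.
Qed.

Lemma neighbourhood_free u : edge_form (adj u) (adj u) = 0.
Proof.
apply: big1 => x _; apply: big1 => y _.
by rewrite [adj u x]adjC [adj u y]adjC adj_tri.
Qed.

Lemma adj_disjoint u v x : e u v -> adj u x + adj v x <= 1.
Proof.
move=> uv; have := adj_tri u v x; rewrite {1}/adj uv mul1r /adj => /eqP.
by rewrite -natrM -natrD pnatr_eq0 lern1; case: (e u x); case: (e v x).
Qed.

Section Dense.
Hypothesis dense : locally_dense.

(** S is completed by a multiple of f to the total 0.579 N; the factor 1000 D clears the
    denominators. *)
Lemma locally_dense_split (S f : T -> R) :
  let D := weight f in let E := 579%:R * N - 1000%:R * weight S in
  let w x := 1000%:R * D * S x + E * f x in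
  (forall x, 0 <= S x) -> (forall x, 0 <= f x) -> 0 < D -> 0 <= E ->
  (forall x, w x <= 1000%:R * D) ->
  79%:R * 1000%:R * (N * D) ^+ 2 < edge_form w w.
Proof.
move=> D E w S0 f0 D0 E0 wD.
have ww : weight w = 579%:R * (N * D) by rewrite weightD !weightZ -/D /E; ring.
have N0 : 0 < N.
  rewrite ltr0n lt0n; apply: contraTneq D0 => T0.
  by rewrite /D /weight big_pred0 ?ltxx // => x; have := fintype0 x T0.
have ND : 0 < N * D by rewrite mulr_gt0.
have := dense (w := w).
rewrite ww => H.
suff : 79%:R * 1000%:R * (579%:R * (N * D)) ^+ 2 < 579%:R * 579%:R * edge_form w w by nra.
apply: H; last by rewrite mulr_gt0.
- by move=> x; rewrite addr_ge0 // !mulr_ge0 // ltW.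
- by move=> x; have := wD x; rewrite -(ler_pM2l N0); lra.
Qed.

(** The weight is 1 on N(u), 0 on N(v) and constant on the rest. The constant E / (1000 D) is at
    most 1 because 1000 D - E = 421 N - 1000 deg v, and N(u) spans nothing. *)
Lemma edge_split u v : e u v -> 1000%:R * deg u <= 579%:R * N ->
  1000%:R * deg v <= 421%:R * N -> deg u + deg v < N ->
  79%:R * 1000%:R * (N * weight (off u v)) ^+ 2 <
  2%:R * 1000%:R * (weight (off u v) * (579%:R * N - 1000%:R * deg u)
                    * edge_form (adj u) (off u v))
  + (579%:R * N - 1000%:R * deg u) ^+ 2 * edge_form (off u v) (off u v).
Proof.
move=> uv du dv duv; set C := off u v; set D := weight C; set E := 579%:R * N - _.
have D_def : D = N - deg u - deg v by rewrite /D !weightB /weight sum_const mul1r.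
have E_def : E = 579%:R * N - 1000%:R * weight (adj u) by [].
have C0 x : 0 <= C x by have := adj_disjoint x uv; rewrite /C /off; lra.
have D0 : 0 < D by rewrite D_def; lra.
have E0 : 0 <= E by rewrite /E; lra.
have := locally_dense_split (S := adj u) (f := C) (adj_ge0 u) C0 D0 E0.
rewrite -/D -E_def edge_form_lin neighbourhood_free => H.
suff /H : forall x, 1000%:R * D * adj u x + E * C x <= 1000%:R * D by lra.
move=> x; have C1 : C x <= 1 - adj u x by have := adj_ge0 v x; rewrite /C /off; lra.
have ED : E <= 1000%:R * D by rewrite D_def /E; lra.
have : 0 <= (1000%:R * D - E) * (1 - adj u x) by rewrite mulr_ge0 ?subr_ge0 ?adj_le1.
have : 0 <= E * (1 - adj u x - C x) by rewrite mulr_ge0 // subr_ge0.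
by lra.
Qed.

Section LowDegree.
Hypothesis low_degree : forall x, 1000%:R * deg x <= 421%:R * N.
Hypothesis T_gt0 : (0 < #|T|)%N.

Let N_gt0 : 0 < N. Proof. by rewrite ltr0n. Qed.

Lemma low_degree_edge u v : e u v ->
  79%:R * 1000%:R * (N * weight (off u v)) ^+ 2 <
  2%:R * 1000%:R * (weight (off u v) * (579%:R * N - 1000%:R * deg u)
                    * edge_form (adj u) (off u v))
  + (579%:R * N - 1000%:R * deg u) ^+ 2 * edge_form (off u v) (off u v).
Proof.
move=> uv; have := N_gt0; have du := low_degree u; have dv := low_degree v.
by move=> N0; apply: edge_split => //; lra.
Qed.

(** As deg u <= 0.421 N, the complement of N(u) has at least 0.579 N vertices, so its indicator is
    an admissible weight. *)
Lemma complement_dense u :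
  0 <= 579%:R * 579%:R * edge_form (fun x => 1 - adj u x) (fun x => 1 - adj u x)
       - 79%:R * 1000%:R * weight (fun x => 1 - adj u x) ^+ 2.
Proof.
have W : weight (fun x => 1 - adj u x) = N - deg u.
  by rewrite weightB /weight sum_const mul1r.
have du := low_degree u; have N0 := N_gt0.
rewrite subr_ge0 ltW //; apply: dense; rewrite ?W; last lra.
  by move=> x; rewrite subr_ge0 adj_le1.
move=> x; have : 0 <= N * adj u x by rewrite mulr_ge0 ?adj_ge0 ?ltW.
by lra.
Qed.

(** For a fixed ordered edge, |C| and 579 N - 1000 deg u are themselves sums over a vertex, so each
    product in [low_degree_edge] is a sum over four vertices. *)
Lemma neighbourhood_sum_ge0 : 0 <= sum6 (fun a b c d f g : T => zr R
  (neighbourhood_term (e a b) (e a c) (e b c) (e a d) (e b d) (e c d)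
                      (e a f) (e b f) (e a g) (e b g))).
Proof.
apply: sumr_ge0 => u _; apply: sumr_ge0 => v _.
pose C := off u v; pose E x := 579%:R - 1000%:R * adj u x.
pose P c d := adj c d * (adj u c * C d); pose P' c d := adj c d * (C c * C d).
rewrite (eq_sum4 (G := fun c d f g => adj u v * (2%:R * 1000%:R * (P c d * (C f * E g)) +
  (P' c d * (E f * E g) + - (79%:R * 1000%:R) * (1 * (C f * C g)))))); last first.
  by move=> c d f g; rewrite /neighbourhood_term !zrE !zr_numerals /P /P' /C /off /E /adj; ring.
rewrite sum4Z sum4D sum4Z sum4D sum4Z !sum4_prod.
have -> : weight E = 579%:R * N - 1000%:R * deg u.
  by rewrite weightB weightZ /weight sum_const.
rewrite /adj; case uv: (e u v); last by rewrite mul0r.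
rewrite mul1r; have := low_degree_edge uv.
rewrite -/(edge_form (adj u) C) -/(edge_form C C) -/C.
by under [\sum_c \sum_d 1]eq_bigr do rewrite sum_const; rewrite sum_const; lra.
Qed.

Lemma complement_sum_ge0 : 0 <= sum6 (fun a b c d f g : T => zr R
  (complement_term (e a b) (e b c) (e b d) (e a f) (e a g) (e f g))).
Proof.
apply: sumr_ge0 => u _; do 3![apply: sumr_ge0 => ? _].
rewrite /complement_term; set S := (_ + 715 * _)%BZ.
have S0 : 0 <= zr R S by rewrite /S !zrE !zr_numerals addr_ge0 ?mulr_ge0 ?ler0n.
have -> : \sum_f \sum_g zr R (S * ((1 - b2z (e u f)) * (1 - b2z (e u g)) * (579 * 579 * b2z (e f g) - 79 * 1000)))%BZ =
  zr R S * (579%:R * 579%:R * edge_form (fun x => 1 - adj u x) (fun x => 1 - adj u x)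
       - 79%:R * 1000%:R * weight (fun x => 1 - adj u x) ^+ 2).
  rewrite expr2 {1}/weight mulr_suml /edge_form !mulr_sumr -sumrB mulr_sumr.
  apply: eq_bigr => f _; rewrite !mulr_sumr -sumrB mulr_sumr; apply: eq_bigr => g _.
  by rewrite !zrE !zr_numerals /adj; ring.
by rewrite mulr_ge0 // complement_dense.
Qed.

End LowDegree.
End Dense.

Lemma zr_dot (u v : seq Z) : zr R (dot u v) = 
  \sum_(i < 4) zr R (nth 0%BZ u i) * zr R (nth 0%BZ v i).
Proof. by rewrite /dot !zrE !big_ord_recr big_ord0 /= add0r. Qed.

(** The double sum is, coordinate by coordinate, the square of the sum of the h i. *)
Lemma dot_sum_ge0 (I : finType) (h : I -> seq Z) :
  0 <= \sum_(i : I) \sum_(j : I) zr R (dot (h i) (h j)).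
Proof.
under eq_bigr do under eq_bigr do rewrite zr_dot.
under eq_bigr do rewrite exchange_big.
rewrite exchange_big sumr_ge0 // => k _.
under eq_bigr do rewrite -mulr_sumr.
by rewrite -mulr_suml -expr2 sqr_ge0.
Qed.

Lemma pair_sum_ge0 : 0 <= sum6 (fun a b c d f g : T => zr R
  (pair_term (e a b) (e a c) (e b c) (e a d) (e b d) (e c d)
             (e a f) (e b f) (e a g) (e b g) (e f g))).
Proof.
apply: sumr_ge0 => a _; apply: sumr_ge0 => b _; rewrite /pair_term.
set rows := if _ then _ else _.
pose h (p : T * T) :=
  flag_row rows [:: e p.1 p.2; e a p.1; e b p.1; e a p.2; e b p.2].
have := dot_sum_ge0 h; congr (_ <= _).
rewrite [RHS]pair_big; apply: eq_bigr => -[c d] _ /=.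
by rewrite [RHS]pair_big; apply: eq_bigr => -[f g] _.
Qed.

Lemma quadruple_sum_ge0 : 0 <= sum6 (fun a b c d f g : T => zr R
  (quadruple_term (e a b) (e a c) (e b c) (e a d) (e b d) (e c d)
     (e a f) (e b f) (e c f) (e d f) (e a g) (e b g) (e c g) (e d g))).
Proof.
apply: sumr_ge0 => a _; apply: sumr_ge0 => b _; apply: sumr_ge0 => c _.
apply: sumr_ge0 => d _; rewrite /quadruple_term.
have zero : 0 <= \sum_(f : T) \sum_(g : T) zr R 0%BZ by do 2!apply: sumr_ge0 => ? _.
case: (e a b) => //; case: (_ || _) => //.
exact: (dot_sum_ge0 (fun x =>
  flag_row edge_and_points_squares [:: e a x; e b x; e c x; e d x])).
Qed.

Lemma low_degree_not_dense : (0 < #|T|)%N ->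
  (forall x, 1000%:R * deg x <= 421%:R * N) -> ~ locally_dense.
Proof.
move=> T0 low dense.
have := certificate_sum_lt0 R e_sym e_tri T0; apply/negP; rewrite -leNgt.
have -> : code_sum e (fun c => zr R (certificate c)) =
  sum6 (fun a b c d f g => 5%:R * 1000%:R * zr R
  (neighbourhood_term (e a b) (e a c) (e b c) (e a d) (e b d) (e c d)
                      (e a f) (e b f) (e a g) (e b g))) + 
  sum6 (fun a b c d f g : T => zr R
  (complement_term (e a b) (e b c) (e b d) (e a f) (e a g) (e f g))) + 
  sum6 (fun a b c d f g : T => zr R
  (pair_term (e a b) (e a c) (e b c) (e a d) (e b d) (e c d)
             (e a f) (e b f) (e a g) (e b g) (e f g))) +
  sum6 (fun a b c d f g : T => zr R
  (quadruple_term (e a b) (e a c) (e b c) (e a d) (e b d) (e c d)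
     (e a f) (e b f) (e c f) (e d f) (e a g) (e b g) (e c g) (e d g))).
  rewrite -!sum6D; apply: eq_sum6 => a b c d f g.
  by rewrite /code /certificate /certificate_at !zrD zrM zrM !zr_numerals.
rewrite sum6Z.
have neigh := neighbourhood_sum_ge0 dense low T0.
have compl := complement_sum_ge0 dense low T0.
have pair := pair_sum_ge0; have quad := quadruple_sum_ge0.
by rewrite !addr_ge0 // mulr_ge0 // -natrM ler0n.
Qed.

End EdgeForm.

(** * Graphs of large maximum degree *)

(** Multiplied by 4 q, the left side is b^2 + 4 q c - (2 q x - b)^2. *)
Lemma quadratic_le0 (R : realFieldType) (q b c x : R) : 0 < q ->
  b ^+ 2 + 4%:R * q * c <= 0 -> - q * x ^+ 2 + b * x + c <= 0.
Proof.
move=> q0 disc; rewrite -(pmulr_rle0 _ (_ : 0 < 4%:R * q)); last lra.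
have := sqr_ge0 (2%:R * q * x - b); lra.
Qed.

(* 433482/10^6 - 842/1000 a is 0.079 - 2 * 0.421 (a - 0.421); the multiplier
   18/1000 was found numerically. *)
Lemma middle_degree_ineq (R : realFieldType) (a c d : R) :
  421%:R / 1000%:R <= a <= 1 / 2%:R -> 0 <= c -> c <= d -> d <= a ->
  (1 - a) * ((579%:R / 1000%:R - a) * (a * c + d * (a - 2%:R * c))
             - 79%:R / 1000%:R * (a - c))
  + 18%:R / 1000%:R *
    ((1 - a) * (d - c) - (433482%:R / 1000000%:R - 842%:R / 1000%:R * a)) <= 0.
Proof.
move=> /andP[a1 a2] c0 cd da.
set E := 579%:R / 1000%:R - a; set r := 1 - a; set G := _ - 842%:R / 1000%:R * a.
have E0 : 0 < E by rewrite /E; lra.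
have r0 : 0 < r by rewrite /r; lra.
(* [psi] is affine in d, so it suffices to bound it at d = c, where it is a concave quadratic in c,
   and at d = a. *)
set psi := fun d => r * (E * (a * c + d * (a - 2%:R * c)) - 79%:R / 1000%:R * (a - c))
  + 18%:R / 1000%:R * (r * (d - c) - G).
rewrite -[X in X <= 0]/(psi d).
have psi_c : psi c <= 0.
  have -> : psi c = - (2%:R * r * E) * c ^+ 2
     + r * (2%:R * a * E + 79%:R / 1000%:R) * c
     + (- (79%:R / 1000%:R) * a * r - 18%:R / 1000%:R * G) by rewrite /psi; ring.
  apply: quadratic_le0; first by rewrite !mulr_gt0.
  rewrite /G /E /r; pose s := a - 421%:R / 1000%:R.
  have s0 : 0 <= s by rewrite /s; clear -a1; lra.
  have s1 : 0 <= 79%:R / 1000%:R - s by rewrite /s; clear -a2; lra.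
  have ss := mulr_ge0 s0 s1; have sss := mulr_ge0 s0 ss; have ssss := mulr_ge0 s0 sss.
  have s5 : 0 <= s * (s * (s * (s * s))) by rewrite !mulr_ge0.
  (* The discriminant is (0.579 - s) P, with s = a - 0.421 in [0, 0.079]. *)
  pose P := (579%:R / 1000%:R - s) *
    (2%:R * (421%:R / 1000%:R + s) * (158%:R / 1000%:R - s) + 79%:R / 1000%:R) ^+ 2
    - 8%:R * (158%:R / 1000%:R - s) *
    (79%:R / 1000%:R * (421%:R / 1000%:R + s) * (579%:R / 1000%:R - s)
     + 18%:R / 1000%:R * (79%:R / 1000%:R - 842%:R / 1000%:R * s)).
  have P0 : P <= 0 by rewrite /P; clear -ss sss ssss s5 s0; lra.
  have -> : a = 421%:R / 1000%:R + s by rewrite /s; ring.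
  rewrite [X in X <= 0](_ : _ = (579%:R / 1000%:R - s) * P); last by rewrite /P; clear; field.
  by apply: mulr_ge0_le0 => //; lra.
have psi_a : psi a <= 0.
  have -> : psi a = (a - c) * (r * (E * a - 61%:R / 1000%:R)) - 18%:R / 1000%:R * G.
    by rewrite /psi; ring.
  have G0 : 0 <= G by rewrite /G; lra.
  (* If the bracket is positive, the worst case is c = 0. The constant 61 is 79 - 18. *)
  have [p0|/ltW p0] := leP (E * a - 61%:R / 1000%:R) 0.
    have : (a - c) * (r * (E * a - 61%:R / 1000%:R)) <= 0.
      by rewrite mulr_ge0_le0 ?mulr_ge0_le0 //; lra.
    by clear -G0; lra.
  have : 0 <= c * (r * (E * a - 61%:R / 1000%:R)) by rewrite !mulr_ge0 // ltW.
  suff : a * (r * (E * a - 61%:R / 1000%:R)) <= 18%:R / 1000%:R * G by clear; lra.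
  rewrite /r /E /G; pose s := a - 421%:R / 1000%:R.
  have s0 : 0 <= s by rewrite /s; clear -a1; lra.
  have s1 : 0 <= 79%:R / 1000%:R - s by rewrite /s; clear -a2; lra.
  have ss := mulr_ge0 s0 s1; have sss := mulr_ge0 s0 ss; have ssss := mulr_ge0 s0 sss.
  have -> : a = 421%:R / 1000%:R + s by rewrite /s; ring.
  by have s2 := sqr_ge0 s; clear -s0 s1 ss sss ssss s2; lra.
have [ca|ac] := ltP c a; last by have -> : d = c by clear -ac cd da; lra.
rewrite -(pmulr_rle0 _ (_ : 0 < a - c)); last by clear -ca; lra.
have -> : (a - c) * psi d = (a - d) * psi c + (d - c) * psi a by rewrite /psi; ring.
have : (a - d) * psi c <= 0 by rewrite mulr_ge0_le0 // subr_ge0.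
have : (d - c) * psi a <= 0 by rewrite mulr_ge0_le0 // subr_ge0.
by move: (_ * psi a) (_ * psi c) => x y; clear; lra.
Qed.

Section HighDegree.
Variables (R : realFieldType) (T : finType) (e : rel T).
Hypothesis e_sym : symmetric e.
Hypothesis e_tri : forall x y z, e x y -> e y z -> ~~ e x z.

Local Notation N := (#|T|%:R : R).
Local Notation adj := (adj R e).
Local Notation deg := (deg R e).
Local Notation edge_form := (edge_form e).
Local Notation edges2 := (\sum_x deg x).

(** As N(u) is independent, this counts the edges between N(u) and its complement. *)
Definition nbr_deg (u : T) : R := \sum_x adj u x * deg x.
Definition codeg (u x : T) : R := \sum_v adj u v * adj v x.

Lemma codeg_ge0 u x : 0 <= codeg u x.
Proof. by apply: sumr_ge0 => v _; rewrite mulr_ge0 ?adj_ge0. Qed.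

Lemma codeg_le u x : codeg u x <= deg x.
Proof.
apply: ler_sum => v _; rewrite [adj v x]adjC //.
by rewrite ler_piMl ?adj_ge0 ?adj_le1.
Qed.

Lemma codeg_adj u x : adj u x * codeg u x = 0.
Proof.
rewrite /codeg mulr_sumr big1 // => v _.
by rewrite [adj v x]adjC // adj_tri.
Qed.

Lemma sum_codeg u : \sum_x codeg u x = nbr_deg u.
Proof. by rewrite exchange_big; apply: eq_bigr => v _; rewrite -mulr_sumr. Qed.

Lemma sum_codeg_deg u : \sum_x codeg u x * deg x = \sum_v adj u v * nbr_deg v.
Proof.
under eq_bigr do rewrite mulr_suml.
rewrite exchange_big; apply: eq_bigr => v _; rewrite mulr_sumr.
by apply: eq_bigr => x _; rewrite mulrA.
Qed.

Lemma nbr_form u : edge_form (adj u) (fun x => 1 - adj u x) = nbr_deg u.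
Proof.
rewrite -[LHS]addr0 -(neighbourhood_free R e_sym e_tri u).
rewrite !(edge_formC e_sym (adj u)) -edge_formDl.
rewrite (edge_formC e_sym) -[RHS](edge_form_1r e (adj u)).
by apply: eq_bigr => x _; apply: eq_bigr => y _; rewrite subrK.
Qed.

Lemma complement_form u :
  edge_form (fun x => 1 - adj u x) (fun x => 1 - adj u x) =
  edges2 - 2%:R * nbr_deg u.
Proof.
rewrite edge_formBl nbr_form (edge_formC e_sym) edge_formBl edge_form_1r.
rewrite [edge_form (adj u) _]edge_form_1r -[\sum_x adj u x * _]/(nbr_deg u).
by under eq_bigr do rewrite mul1r; lra.
Qed.

Lemma nbr_deg_le u k : (forall v, e u v -> deg v <= k) -> nbr_deg u <= deg u * k.
Proof.
move=> degk; rewrite /nbr_deg /deg mulr_suml; apply: ler_sum => x _.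
by rewrite /adj; case ux: (e u x); rewrite ?mul0r // !mul1r degk.
Qed.

Lemma weight_complement u : weight (fun x => 1 - adj u x) = N - deg u.
Proof. by rewrite weightB /weight sum_const mul1r. Qed.

(** Since N(u) is independent, every edge meets its complement, so the degrees there sum to at least
    the number of edges; each is at most deg u. *)
Lemma edges2_le u : (forall x, deg x <= deg u) ->
  edges2 <= 2%:R * (deg u * (N - deg u)).
Proof.
move=> umax; have comp0 x : 0 <= 1 - adj u x by rewrite subr_ge0 adj_le1.
have := edge_form_ge0 e comp0 comp0; rewrite complement_form.
suff : edges2 - nbr_deg u <= deg u * (N - deg u) by lra.
rewrite -weight_complement -weightZ -sumrB; apply: ler_sum => x _.
by have := ler_wpM2l (comp0 x) (umax x); lra.
Qed.

Hypothesis dense : locally_dense R e.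
Hypothesis T_gt0 : (0 < #|T|)%N.

Let N_gt0 : 0 < N. Proof. by rewrite ltr0n. Qed.

(** Test weight: 1 off N(u), constant on N(u). The resulting inequality is divided by 1000 deg u. *)
Lemma nbr_complement_dense u : 0 < deg u -> 421%:R * N <= 1000%:R * deg u ->
  79%:R * N ^+ 2 * deg u <
  1000%:R * deg u * (edges2 - 2%:R * nbr_deg u)
  + 2%:R * (1000%:R * deg u - 421%:R * N) * nbr_deg u.
Proof.
move=> u0 u421; set a := deg u; set E := 1000%:R * a - 421%:R * N.
have E0 : 0 <= E by rewrite /E subr_ge0.
have comp0 x : 0 <= 1 - adj u x by rewrite subr_ge0 adj_le1.
have := locally_dense_split dense comp0 (adj_ge0 R e u) u0.
rewrite weight_complement -/a.
have -> : 579%:R * N - 1000%:R * (N - a) = E by rewrite /E; lra.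
rewrite edge_form_lin // (edge_formC e_sym _ (adj u)) nbr_form complement_form.
rewrite -[weight _]/a neighbourhood_free // => /(_ E0) H.
have wD x : 1000%:R * a * (1 - adj u x) + E * adj u x <= 1000%:R * a.
  have : 0 <= (1000%:R * a - E) * adj u x.
    by rewrite mulr_ge0 ?adj_ge0 // /E; have := N_gt0; lra.
  by lra.
have {H wD} H := H wD; rewrite -(ltr_pM2l (_ : 0 < 1000%:R * a)); last by rewrite mulr_gt0.
by move: H; lra.
Qed.

Lemma half_degree_not_dense u : (forall x, deg x <= deg u) ->
  N <= 2%:R * deg u -> False.
Proof.
move=> umax uN; have N0 := N_gt0; have u0 : 0 < deg u by lra.
have [u579|u579] := ltP (579%:R * N) (1000%:R * deg u).
  (* N(u) alone is an admissible weight here, and it spans nothing. *)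
  have := dense (adj_ge0 R e u); rewrite neighbourhood_free // mulr0.
  rewrite -[weight _]/(deg u) => H.
  suff /H/(_ u0) : forall x, 579%:R * N * adj u x <= 1000%:R * deg u.
    by have := sqr_ge0 (deg u); lra.
  move=> x; have : N * adj u x <= N by rewrite ler_piMr ?adj_le1 // ltW.
  by lra.
have comp0 x : 0 <= 1 - adj u x by rewrite subr_ge0 adj_le1.
have D0 : 0 < N - deg u by lra.
have E0 : 0 <= 579%:R * N - 1000%:R * deg u by lra.
have := locally_dense_split dense (adj_ge0 R e u) comp0.
rewrite weight_complement -[weight _]/(deg u) edge_form_lin // nbr_form.
rewrite neighbourhood_free // complement_form => /(_ D0 E0) H.
have Mle := edges2_le umax.
set a := deg u in H Mle uN u0 D0 E0 u579 *; set F := nbr_deg u in H.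
set D := N - a in H D0 Mle; set E := 579%:R * N - 1000%:R * a in H E0.
have ED : E <= 1000%:R * D by rewrite /E /D; lra.
(* As E <= 1000 D, replacing E^2 by 1000 D E in the second term leaves 1000 D E times [edges2],
   which [edges2_le] bounds. *)
have {H} H : 79%:R * 1000%:R * (N * D) ^+ 2 < 2%:R * 1000%:R * E * D * (a * D).
  have : 0 <= E * (1000%:R * D - E) * (edges2 - 2%:R * F).
    have G0 : 0 <= edges2 - 2%:R * F by rewrite -complement_form edge_form_ge0.
    by rewrite mulr_ge0 // mulr_ge0 // subr_ge0.
  have : 0 <= 1000%:R * E * D * (2%:R * (a * D) - edges2).
    by rewrite mulr_ge0 ?subr_ge0 ?Mle // !mulr_ge0 ?ler0n ?(ltW D0).
  suff /H : forall x, 1000%:R * D * adj u x + E * (1 - adj u x) <= 1000%:R * D by lra.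
  move=> x; have : 0 <= (1000%:R * D - E) * (1 - adj u x) by rewrite mulr_ge0 ?comp0 // subr_ge0.
  by lra.
(* N / 2 and 0.079 N are the roots in a of 79 N^2 - 2 E a. *)
have : 0 <= D ^+ 2 * ((a - N / 2%:R) * (a - 79%:R / 1000%:R * N)).
  by rewrite mulr_ge0 ?sqr_ge0 // mulr_ge0; lra.
by move: H; rewrite /E; lra.
Qed.

(** In the sum of the bounds for u and v, [edges2 - nbr_deg u - nbr_deg v] is the degree sum over
    the common non-neighbours. Bounding these degrees by N / 2 gives 158 N^2 on both sides of a
    strict inequality. *)
Lemma large_edge_not_dense u v : (forall x, 2%:R * deg x <= N) -> e u v ->
  421%:R * N <= 1000%:R * deg u -> 421%:R * N <= 1000%:R * deg v -> False.
Proof.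
move=> half uv u421 v421; have N0 := N_gt0.
have bound w : 421%:R * N <= 1000%:R * deg w ->
    79%:R * N ^+ 2 < 1000%:R * (edges2 - 2%:R * nbr_deg w)
                     + (1000%:R * deg w - 421%:R * N) * N.
  move=> w421; have w0 : 0 < deg w by lra.
  have Fw : nbr_deg w <= deg w * (N / 2%:R).
    by apply: nbr_deg_le => x _; have := half x; lra.
  rewrite -(ltr_pM2r w0); have := nbr_complement_dense w0 w421.
  have : 0 <= (1000%:R * deg w - 421%:R * N) * (deg w * (N / 2%:R) - nbr_deg w).
    by rewrite mulr_ge0 ?subr_ge0.
  by lra.
have Bu := bound _ u421; have Bv := bound _ v421.
suff : edges2 - nbr_deg u - nbr_deg v <= (N - deg u - deg v) * (N / 2%:R) by lra.
have <- : weight (off R e u v) = N - deg u - deg v.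
  by rewrite !weightB /weight sum_const mul1r.
rewrite /weight mulr_suml -!sumrB; apply: ler_sum => x _.
have off0 : 0 <= off R e u v x by have := adj_disjoint R e_tri x uv; rewrite /off; lra.
have := ler_wpM2l off0 (half x); rewrite /off; lra.
Qed.

(** Off N(v) the weight 1 is [adj u] plus [off u v], so the last factor is 2 X + Y; E <= 1000 D
    turns the E^2 Y of [edge_split] into 1000 D E Y. *)
Lemma neighbour_dense u v : e u v -> 1000%:R * deg u <= 579%:R * N ->
  1000%:R * deg v <= 421%:R * N -> deg u + deg v < N ->
  79%:R * N ^+ 2 * (N - deg u - deg v) <=
  (579%:R * N - 1000%:R * deg u) * (edges2 - 2%:R * nbr_deg v).
Proof.
move=> uv du dv duv; have := edge_split e_sym e_tri dense uv du dv duv.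
rewrite -complement_form.
rewrite (@eq_edge_form _ _ _ (fun x => 1 - adj v x)
  (fun x => 1 * adj u x + 1 * off R e u v x)); last by move=> x; rewrite /off; lra.
rewrite edge_form_lin // neighbourhood_free //.
have -> : weight (off R e u v) = N - deg u - deg v.
  by rewrite !weightB /weight sum_const mul1r.
have off0 x : 0 <= off R e u v x by have := adj_disjoint R e_tri x uv; rewrite /off; lra.
have := edge_form_ge0 e off0 off0.
set X := edge_form (adj u) _; set Y := edge_form _ _ => Y0.
set D := N - deg u - deg v; set E := 579%:R * N - _ => H.
have D0 : 0 < D by rewrite /D; lra.
have E0 : 0 <= E by rewrite /E; lra.
have EY : 0 <= E * Y * (1000%:R * D - E).
  by rewrite !mulr_ge0 // /D /E; lra.
rewrite -(ler_pM2l (_ : 0 < 1000%:R * D)); last by rewrite mulr_gt0.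
by move: H EY; lra.
Qed.

Lemma middle_degree_ineq_hom (a c d n : R) : 0 < n ->
  421%:R * n <= 1000%:R * a -> 2%:R * a <= n -> 0 <= c -> c <= d -> d <= a ->
  (n - a) * ((579%:R * n - 1000%:R * a) * (a * c + d * (a - 2%:R * c))
             - 79%:R * n ^+ 2 * (a - c))
  + 18%:R * n ^+ 2 * ((n - a) * (d - c)
    - (433482%:R / 1000000%:R * n ^+ 2 - 842%:R / 1000%:R * a * n)) <= 0.
Proof.
move=> n0 a1 a2 c0 cd da.
have ha : 421%:R / 1000%:R <= a / n <= 1 / 2%:R.
  by rewrite ler_pdivlMr // ler_pdivrMr //; apply/andP; split; lra.
have hc : 0 <= c / n by rewrite divr_ge0 // ltW.
have hcd : c / n <= d / n by rewrite ler_pM2r ?invr_gt0.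
have hda : d / n <= a / n by rewrite ler_pM2r ?invr_gt0.
have := middle_degree_ineq ha hc hcd hda; rewrite -(pmulr_rle0 _ (_ : 0 < 1000%:R * n ^+ 4)); last first.
  by rewrite mulr_gt0 // exprn_gt0.
congr (_ <= 0); field; exact: lt0r_neq0.
Qed.

(* [neighbour_dense] is summed over the neighbours v of u; in terms of the
   codegrees with u this becomes a sum over the vertices off N(u), which is
   nonpositive termwise. *)
Lemma middle_degree_not_dense u : (forall x, deg x <= deg u) ->
  421%:R * N <= 1000%:R * deg u -> 2%:R * deg u <= N ->
  (forall v, e u v -> 1000%:R * deg v <= 421%:R * N) -> False.
Proof.
move=> umax u421 u2 nbr_low; have N0 := N_gt0; set a := deg u in umax u421 u2.
have a0 : 0 < a by lra.
have Fa : nbr_deg u <= a * (421%:R / 1000%:R * N).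
  by apply: nbr_deg_le => v /nbr_low; lra.
(* [nbr_complement_dense] with [nbr_deg u] replaced by its upper bound 0.421 a N. *)
pose G0 := 433482%:R / 1000000%:R * N ^+ 2 - 842%:R / 1000%:R * a * N.
have G_gt : G0 < edges2 - 2%:R * nbr_deg u.
  have := nbr_complement_dense a0 u421; rewrite -/a => I.
  have J : 0 <= (1000%:R * a - 421%:R * N) * (a * (421%:R / 1000%:R * N) - nbr_deg u).
    by rewrite mulr_ge0 ?subr_ge0.
  rewrite -(ltr_pM2l (_ : 0 < 1000%:R * a)) ?mulr_gt0 // /G0; move: I J; lra.
have sum_ge0 : 0 <= (579%:R * N - 1000%:R * a) *
    (a * edges2 - 2%:R * \sum_x codeg u x * deg x)
    - 79%:R * N ^+ 2 * (a * (N - a) - nbr_deg u).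
  have : 0 <= \sum_v adj u v * ((579%:R * N - 1000%:R * a) * (edges2 - 2%:R * nbr_deg v)
      - 79%:R * N ^+ 2 * (N - a - deg v)).
    apply: sumr_ge0 => v _; rewrite {1}/adj; case uv: (e u v); rewrite ?mul0r // mul1r.
    by rewrite subr_ge0; have := nbr_low v uv; have := neighbour_dense uv; rewrite -/a => H ?; apply: H; lra.
  congr (_ <= _).
  rewrite sum_codeg_deg.
  transitivity (\sum_v (((579%:R * N - 1000%:R * a) * edges2 - 79%:R * N ^+ 2 * (N - a)) * adj u v
    + (- (2%:R * (579%:R * N - 1000%:R * a)) * (adj u v * nbr_deg v)
       + 79%:R * N ^+ 2 * (adj u v * deg v)))).
    by apply: eq_bigr => v _; ring.
  rewrite !big_split /= -!mulr_sumr -[\sum_v adj u v]/a.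
  by rewrite -[\sum_v adj u v * deg v]/(nbr_deg u); ring.
have : \sum_x (1 - adj u x) * ((N - a) *
    ((579%:R * N - 1000%:R * a) * (a * codeg u x + deg x * (a - 2%:R * codeg u x))
     - 79%:R * N ^+ 2 * (a - codeg u x))
    + 18%:R * N ^+ 2 * ((N - a) * (deg x - codeg u x) - G0)) <= 0.
  apply: sumr_le0 => x _; rewrite mulr_ge0_le0 ?subr_ge0 ?adj_le1 //.
  by apply: middle_degree_ineq_hom; rewrite ?codeg_ge0 ?codeg_le.
apply/negP; rewrite -ltNge.
set K := 579%:R * N - 1000%:R * a.
(* Products of [adj u x] and [codeg u x] vanish by [codeg_adj]; what remains is a combination of
   four terms with known sums. *)
rewrite (eq_bigr (fun x =>
   ((N - a) * (K * a + 79%:R * N ^+ 2) - 18%:R * N ^+ 2 * (N - a)) * codeg u x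
   + ((N - a) * K * a + 18%:R * N ^+ 2 * (N - a)) * (deg x - adj u x * deg x)
   + (- 2%:R * (N - a) * K) * (codeg u x * deg x)
   + (- (N - a) * 79%:R * N ^+ 2 * a - 18%:R * N ^+ 2 * G0) * (1 - adj u x))); last first.
  move=> x _; have := codeg_adj u x; rewrite mulrC => cA.
  apply/eqP; rewrite -subr_eq0; apply/eqP; rewrite -[RHS](mul0r
    ((N - a) * K * 2%:R * deg x - (N - a) * (K * a + 79%:R * N ^+ 2) + 18%:R * N ^+ 2 * (N - a))) -cA.
  ring.
rewrite !big_split -!mulr_sumr /= sum_codeg sumrB -[\sum_x adj u x * _]/(nbr_deg u).
rewrite -[\sum_x (1 - _)]/(weight _) weight_complement -/a.
move: sum_ge0 G_gt; rewrite -/K; set F := nbr_deg u; set X := \sum_x codeg u x * deg x.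
set M := edges2; move=> sum_ge0 G_gt.
have r0 : 0 < N - a by lra.
(* The sum is N - a times the quantity in [sum_ge0] plus a positive multiple of the gap in
   [G_gt]. *)
have := mulr_ge0 (ltW r0) sum_ge0.
have : 0 < 18%:R * N ^+ 2 * (N - a) * (M - 2%:R * F - G0).
  by rewrite mulr_gt0 ?subr_gt0 // mulr_gt0 // mulr_gt0 // exprn_gt0.
clear; lra.
Qed.

End HighDegree.

Lemma not_locally_dense (R : realFieldType) (T : finType) (e : rel T) :
  symmetric e -> (forall x y z, e x y -> e y z -> ~~ e x z) -> (0 < #|T|)%N ->
  ~ locally_dense R e.
Proof.
move=> e_sym e_tri T0 dense; have [u umax] := max_deg R e T0.
have [half|half] := leP (#|T|%:R) (2%:R * deg R e u).
  exact: half_degree_not_dense dense T0 _ umax half.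
have halfx x : 2%:R * deg R e x <= #|T|%:R by have := umax x; lra.
have [low|high] := leP (1000%:R * deg R e u) (421%:R * #|T|%:R).
  by apply: (low_degree_not_dense e_sym e_tri T0) dense => x; have := umax x; lra.
apply: (middle_degree_not_dense e_sym e_tri dense T0 umax); rewrite ?ltW // => v uv.
rewrite leNgt; apply/negP => vhigh.
by apply: (large_edge_not_dense e_sym e_tri dense T0 halfx uv); rewrite ltW.
Qed.

(** * From sets to weights *)

Section Rounding.
Variables (R : realFieldType) (T : finType) (e : rel T).
Hypothesis e_sym : symmetric e.
Hypothesis e_irr : irreflexive e.

Local Notation N := (#|T|%:R : R).

(** Each spanned edge is the image of two ordered pairs, which differ by irreflexivity. *)
Lemma spanned_edges_le (S : {set T}) :
  2%:R * #|spanned_edges e S|%:R <=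
  edge_form e (fun x => (x \in S)%:R : R) (fun x => (x \in S)%:R).
Proof.
pose P := [set p : T * T | [&& e p.1 p.2, p.1 \in S & p.2 \in S]].
pose h (p : T * T) := [set p.1; p.2].
have -> : edge_form e (fun x => (x \in S)%:R : R) (fun x => (x \in S)%:R) = #|P|%:R.
  rewrite /edge_form pair_big -sum1_card natr_sum [RHS]big_mkcond /=.
  apply: eq_bigr => -[x y] _; rewrite inE /adj /=.
  by case: (e x y); case: (x \in S); case: (y \in S); rewrite ?(mul0r, mulr0, mulr1).
rewrite -natrM ler_nat -[X in (_ <= X)%N]sum1_card (partition_big_imset h) /=.
have sub : spanned_edges e S \subset h @: P.
  apply/subsetP => E; rewrite inE => /andP[/imsetP[p]]; rewrite inE => ep -> ES.
  by apply: imset_f; rewrite inE ep !(subsetP ES) ?set21 ?set22.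
rewrite mulnC (leq_trans (leq_mul (subset_leq_card sub) (leqnn 2))) //.
rewrite -sum_nat_const; apply: leq_sum => _ /imsetP[[x y] xyP ->].
have xy : x != y.
  by apply: contraTneq xyP => ->; rewrite inE /= e_irr.
have two : #|[set (x, y); (y, x)]| = 2%N.
  by rewrite cards2; case: eqP => // -[xy_eq]; rewrite xy_eq eqxx in xy.
rewrite sum1dep_card -two; apply: subset_leq_card; apply/subsetP => p.
rewrite !inE => /orP[] /eqP->; move: xyP; rewrite !inE /= /h /= ?eqxx ?andbT //.
by rewrite setUC eqxx andbT e_sym => /and3P[-> -> ->].
Qed.

Definition delta (x z : T) : R := (z == x)%:R.

Lemma edge_form_delta x w : edge_form e (delta x) w = \sum_y adj R e x y * w y.
Proof.
rewrite /edge_form (bigD1 x) //= [X in _ + X]big1 ?addr0 => [|z /negPf zx].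
  by apply: eq_bigr => y _; rewrite /delta eqxx mul1r.
by apply: big1 => y _; rewrite /delta zx mul0r mulr0.
Qed.

Lemma edge_form_delta2 x y : edge_form e (delta x) (delta y) = adj R e x y.
Proof.
rewrite edge_form_delta (bigD1 y) //= [X in _ + X]big1 => [|z /negPf zy].
  by rewrite /delta eqxx mulr1 addr0.
by rewrite /delta zy mulr0.
Qed.

Lemma weight_delta x : weight (delta x) = 1.
Proof.
by rewrite /weight (bigD1 x) //= /delta eqxx big1 ?addr0 // => z /negPf->.
Qed.

(* The edge form is concave along the directions [delta x - delta y]. *)
Lemma edge_form_shift w x y t : 0 <= t ->
  edge_form e (delta x) w <= edge_form e (delta y) w ->
  edge_form e (fun z => 1 * w z + t * (delta x z - delta y z))
              (fun z => 1 * w z + t * (delta x z - delta y z)) <= edge_form e w w.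
Proof.
move=> t0 xy; rewrite edge_form_lin //.
have -> : edge_form e w (fun z => delta x z - delta y z) =
    edge_form e (delta x) w - edge_form e (delta y) w.
  by rewrite edge_formC // edge_formBl.
have adj_irr z : adj R e z z = 0 by rewrite /adj e_irr.
have -> : edge_form e (fun z => delta x z - delta y z) (fun z => delta x z - delta y z)
    = - (2%:R * adj R e x y).
  set f := fun z => delta x z - delta y z; rewrite {1}/f edge_formBl.
  rewrite (edge_formC e_sym (delta x)) (edge_formC e_sym (delta y)) /f.
  by rewrite !edge_formBl !edge_form_delta2 !adj_irr (adjC R e_sym y x); ring.
have := adj_ge0 R e x y; have := sqr_ge0 t; nra.
Qed.

Definition fractional (w : T -> R) : {set T} := [set x | 0 < w x < 1].

Lemma integral_coord w x : 0 <= w x <= 1 -> x \notin fractional w ->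
  w x = (w x == 1)%:R.
Proof.
move=> /andP[w0 w1]; rewrite inE.
have [//|w1'] := eqVneq (w x) 1; rewrite lt_neqAle w0 lt_neqAle w1' w1 !andbT.
by rewrite negbK => /eqP<-.
Qed.

(** A single fractional coordinate would make the total non-integral. *)
Lemma second_fractional w k x : (forall z, 0 <= w z <= 1) -> weight w = k%:R ->
  x \in fractional w -> exists2 y, y \in fractional w & y != x.
Proof.
move=> w01 wk xf; apply/exists_inP; apply: contraT; rewrite negb_exists_in.
move=> /forall_inP only_x.
have : weight w = w x + (\sum_(z | z != x) (w z == 1)%:R).
  rewrite /weight (bigD1 x) //=; congr (_ + _); apply: eq_bigr => z zx.
  by apply: integral_coord => //; apply: contra zx => /only_x; rewrite negbK.
rewrite wk -natr_sum; set m := (\sum_(z | _) _)%N => km.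
move: xf; rewrite inE => /andP[w0 w1].
have mk : (m < k)%N by rewrite -(ltr_nat R) km; lra.
have : (k < m.+1)%N by rewrite -(ltr_nat R) km -natr1; lra.
by rewrite ltnS leqNgt mk.
Qed.

(** Induction on the number of fractional coordinates: mass moves between two of them, in the
    direction that does not increase the form, until one becomes integral. *)
Lemma rounding (w : T -> R) k : (forall x, 0 <= w x <= 1) -> weight w = k%:R ->
  exists2 S : {set T}, #|S| = k &
    edge_form e (fun x => (x \in S)%:R : R) (fun x => (x \in S)%:R) <= edge_form e w w.
Proof.
move: {2}#|_|.+1 (ltnSn #|fractional w|) => m.
elim: m w => // m IH w fm w01 wk.
have [f0|[x0 x0f]] := set_0Vmem (fractional w).
  exists [set x | w x == 1]; last first.
    rewrite (@eq_edge_form _ _ e _ w) // => x; rewrite inE.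
    by rewrite -integral_coord // f0 inE.
  apply/eqP; rewrite -(eqr_nat R) -wk -sum1_card natr_sum big_mkcond /=; apply/eqP.
  apply: eq_bigr => x _; rewrite inE [in RHS]integral_coord // ?f0 ?inE //.
  by case: eqP.
have [y0 y0f yx0] := second_fractional w01 wk x0f.
have [x [y [xf yf xy Lxy]]] : exists x y, [/\ x \in fractional w, y \in fractional w,
    x != y & edge_form e (delta x) w <= edge_form e (delta y) w].
  have [L|/ltW L] := leP (edge_form e (delta x0) w) (edge_form e (delta y0) w).
    by exists x0, y0; split=> //; rewrite eq_sym.
  by exists y0, x0; split.
(* The largest shift that keeps both coordinates in [0, 1]. *)
pose t := Num.min (1 - w x) (w y).
have [/andP[wx0 wx1] /andP[wy0 wy1]] : (0 < w x < 1) /\ (0 < w y < 1).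
  by move: xf yf; rewrite !inE.
have t0 : 0 < t by rewrite lt_min subr_gt0 wx1.
have [tx ty] : t <= 1 - w x /\ t <= w y by rewrite /t !ge_min !lexx orbT.
pose w' z := 1 * w z + t * (delta x z - delta y z).
have w'x : w' x = w x + t by rewrite /w' /delta eqxx (negPf xy) mulr0n mulr1n; ring.
have w'y : w' y = w y - t by rewrite /w' /delta [y == x]eq_sym eqxx (negPf xy) mulr0n mulr1n; ring.
have w'z z : z != x -> z != y -> w' z = w z.
  by move=> /negPf zx /negPf zy; rewrite /w' /delta zx zy !mulr0n; ring.
have w'01 z : 0 <= w' z <= 1.
  have [->|zx] := eqVneq z x; first by rewrite w'x; apply/andP; split; lra.
  have [->|zy] := eqVneq z y; first by rewrite w'y; apply/andP; split; lra.
  by rewrite w'z.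
have [||S Sk SQ] := IH w' _ w'01; last first.
- exists S => //; apply: le_trans SQ _.
  exact: edge_form_shift (ltW t0) Lxy.
- by rewrite weightD !weightZ weightB !weight_delta subrr mulr0 addr0 mul1r.
rewrite ltnS in fm; apply: (leq_trans _ fm); apply: proper_card; apply/properP; split.
  apply/subsetP => z; rewrite !inE.
  have [->|zx] := eqVneq z x; first by rewrite wx0 wx1.
  have [->|zy] := eqVneq z y; first by rewrite wy0 wy1.
  by rewrite w'z.
have [tE|tE] : t = 1 - w x \/ t = w y by rewrite /t; case: leP; [left|right].
  by exists x; rewrite // inE w'x tE addrC subrK ltxx andbF.
by exists y; rewrite // inE w'y tE subrr ltxx.
Qed.

End Rounding.

(** * Reduction to the density 0.579 *)

Section Reduction.
Variables (R : realFieldType) (T : finType) (e : rel T).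
Hypothesis e_sym : symmetric e.
Hypothesis e_irr : irreflexive e.
Hypothesis e_tri : forall x y z, e x y -> e y z -> ~~ e x z.
Hypothesis T_gt0 : (0 < #|T|)%N.

Local Notation N := (#|T|%:R : R).

Let N_gt0 : 0 < N. Proof. by rewrite ltr0n. Qed.

Lemma mantel : 2%:R * edge_form e (fun=> 1 : R) (fun=> 1) <= N ^+ 2.
Proof.
have [u /(edges2_le e_sym e_tri) Mle] := max_deg R e T_gt0.
rewrite edge_form_1r; under eq_bigr do rewrite mul1r.
by have := sqr_ge0 (N - 2%:R * deg R e u); lra.
Qed.

(* Moving [w] towards the constant weight 1 increases the edge form at most
   linearly, as [(1 - s) a b + s - ((1 - s) a + s) ((1 - s) b + s)] equals
   [s (1 - s) (1 - a) (1 - b)]. *)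
Lemma edge_form_interpolate (w : T -> R) s : (forall x, w x <= 1) -> 0 <= s <= 1 ->
  edge_form e (fun x => (1 - s) * w x + s) (fun x => (1 - s) * w x + s) <=
  (1 - s) * edge_form e w w + s * edge_form e (fun=> 1) (fun=> 1).
Proof.
move=> w1 /andP[s0 s1]; rewrite /edge_form !mulr_sumr -big_split /=.
apply: ler_sum => x _; rewrite !mulr_sumr -big_split /=; apply: ler_sum => y _.
rewrite -subr_ge0.
have -> : (1 - s) * (adj R e x y * (w x * w y)) + s * (adj R e x y * (1 * 1))
    - adj R e x y * (((1 - s) * w x + s) * ((1 - s) * w y + s)) =
    adj R e x y * (s * (1 - s) * ((1 - w x) * (1 - w y))) by ring.
by rewrite !mulr_ge0 ?adj_ge0 ?subr_ge0.
Qed.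

Variables (alpha beta : R) (k : nat).
Hypothesis alpha_bounds : 579%:R / 1000%:R <= alpha <= 1.
Hypothesis beta_gt : (2%:R * alpha - 1) / 4%:R < beta.
Hypothesis k_le : k%:R <= alpha * N.
Hypothesis sets_dense : forall S : {set T}, #|S| = k ->
  beta * N ^+ 2 <= #|spanned_edges e S|%:R.

Lemma weights_dense (w : T -> R) : (forall x, 0 <= w x <= 1) -> weight w = k%:R ->
  2%:R * beta * N ^+ 2 <= edge_form e w w.
Proof.
move=> w01 wk; have [S Sk SQ] := rounding e_sym e_irr w01 wk.
by apply: le_trans SQ; have := sets_dense Sk; have := spanned_edges_le R e_sym e_irr S; lra.
Qed.

(** If k <= 0.579 N, w is scaled down to total k, which does not increase its form; otherwise it is
    moved towards the constant weight 1 until its total is k. *)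
Lemma weights_dense_579 (w : T -> R) : (forall x, 0 <= w x <= 1) ->
  1000%:R * weight w = 579%:R * N -> 79%:R * N ^+ 2 < 1000%:R * edge_form e w w.
Proof.
move=> w01 wN; have N0 := N_gt0; have /andP[al1 al2] := alpha_bounds.
have w0 x : 0 <= w x by have /andP[] := w01 x.
have w1 x : w x <= 1 by have /andP[] := w01 x.
have N2 : 0 < N ^+ 2 by rewrite exprn_gt0.
have bN : (2%:R * alpha - 1) / 4%:R * N ^+ 2 < beta * N ^+ 2 by rewrite ltr_pM2r.
have aN : 579%:R / 1000%:R * N ^+ 2 <= alpha * N ^+ 2 by rewrite ler_pM2r.
have [kN|kN] := leP (1000%:R * k%:R) (579%:R * N).
  pose s := k%:R / (579%:R / 1000%:R * N).
  have N579 : 0 < 579%:R / 1000%:R * N by rewrite mulr_gt0 // divr_gt0 // ltr0n.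
  have s0 : 0 <= s by rewrite divr_ge0 ?ler0n // ltW.
  have s1 : s <= 1 by rewrite ler_pdivrMr // mul1r; lra.
  have sw01 x : 0 <= s * w x <= 1.
    by rewrite mulr_ge0 //= mulr_ile1.
  have swk : weight (fun x => s * w x) = k%:R.
    rewrite weightZ (_ : weight w = 579%:R / 1000%:R * N); last lra.
    by rewrite divfK // lt0r_neq0.
  have := weights_dense sw01 swk.
  rewrite edge_formZl edge_formC // edge_formZl mulrA => sQ.
  have : s * s * edge_form e w w <= edge_form e w w.
    by rewrite ler_piMl ?edge_form_ge0 // mulr_ile1.
  by lra.
(* Solves (1 - s) 0.579 N + s N = k. *)
pose s := (1000%:R * k%:R - 579%:R * N) / (421%:R * N).
have N421 : 0 < 421%:R * N by rewrite mulr_gt0 // ltr0n.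
have kN1 : k%:R <= N by apply: le_trans k_le _; rewrite ger_pMl.
have s0 : 0 <= s by rewrite divr_ge0 ?subr_ge0 ?(ltW kN) // ltW.
have s1 : s <= 1 by rewrite ler_pdivrMr // mul1r; lra.
have sN : s * (421%:R * N) = 1000%:R * k%:R - 579%:R * N by rewrite divfK // lt0r_neq0.
have sw01 x : 0 <= (1 - s) * w x + s <= 1.
  have : 0 <= (1 - s) * w x by rewrite mulr_ge0 ?subr_ge0.
  have : 0 <= (1 - s) * (1 - w x) by rewrite mulr_ge0 ?subr_ge0.
  by move=> ? ?; apply/andP; split; lra.
have swk : weight (fun x => (1 - s) * w x + s) = k%:R.
  rewrite weightD weightZ /weight sum_const -/(weight w).
  rewrite (_ : weight w = 579%:R / 1000%:R * N); last lra.
  by move: sN; lra.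
have := weights_dense sw01 swk.
have s01 : 0 <= s <= 1 by rewrite s0.
have := edge_form_interpolate w1 s01.
have : s * (2%:R * edge_form e (fun=> 1) (fun=> 1)) <= s * N ^+ 2.
  by rewrite ler_wpM2l // mantel.
have : s * (421%:R * N) * N = (1000%:R * k%:R - 579%:R * N) * N by rewrite sN.
have : k%:R * N <= alpha * N * N by rewrite ler_pM2r.
set Q := edge_form e w w; set M := edge_form e _ _; set V := edge_form e _ _.
move=> h1 h2 h3 h4 h5.
(* No loss occurs: (2 alpha - 1) / 2 is affine, equal to 0.079 at 0.579 and to Mantel's 1/2 at 1. *)
have h6 : 79%:R * (1 - s) * N ^+ 2 < (1 - s) * (1000%:R * Q) by lra.
have s_neq1 : 0 < 1 - s.
  rewrite subr_gt0 lt_neqAle s1 andbT; apply: contraTneq h6 => ->.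
  by rewrite subrr mulr0 !mul0r ltxx.
by rewrite -(ltr_pM2l s_neq1); lra.
Qed.

Lemma locally_dense_of_sets : locally_dense R e.
Proof.
move=> w w0 wN W0; have N0 := N_gt0.
pose s := 579%:R * N / (1000%:R * weight w).
have W1000 : 0 < 1000%:R * weight w by rewrite mulr_gt0 // ltr0n.
have s0 : 0 <= s by rewrite divr_ge0 ?mulr_ge0 ?ler0n // ltW.
have sw01 x : 0 <= s * w x <= 1.
  rewrite mulr_ge0 //=.
  by rewrite /s mulrAC ler_pdivrMr // mul1r.
have swN : 1000%:R * weight (fun x => s * w x) = 579%:R * N.
  by rewrite weightZ mulrCA divfK // lt0r_neq0.
have := weights_dense_579 sw01 swN.
rewrite edge_formZl edge_formC // edge_formZl.
rewrite -(ltr_pM2l (_ : 0 < 1000%:R * weight w ^+ 2)) ?mulr_gt0 ?exprn_gt0 ?ltr0n //.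
have -> : 1000%:R * weight w ^+ 2 * (1000%:R * (s * (s * edge_form e w w))) =
    N ^+ 2 * (579%:R * 579%:R * edge_form e w w).
  by rewrite /s; field; rewrite ?lt0r_neq0.
have -> : 1000%:R * weight w ^+ 2 * (79%:R * N ^+ 2) =
    N ^+ 2 * (79%:R * 1000%:R * weight w ^+ 2) by ring.
by rewrite ltr_pM2l // exprn_gt0.
Qed.

End Reduction.

Theorem theorem1p3 (R : realType) (alpha beta : R)
    (halpha : 579%:R / 1000%:R <= alpha <= 1)
    (hbeta : (2%:R * alpha - 1) / 4%:R < beta) :
  exists n0 : nat,
    forall (T : finType) (e : rel T),
      simple_graph e ->
      (n0 <= #|T|)%N ->
      (forall S : {set T},
          #|S|%:Z = Num.floor (alpha * #|T|%:R) ->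
          beta * #|T|%:R ^+ 2 <= #|spanned_edges e S|%:R) ->
      has_triangle e.
Proof.
(* All the estimates hold for every nonempty vertex set, without error terms in n. *)
exists 1%N => T e [e_sym e_irr] T_gt0 sets_dense.
have [/existsP[x /existsP[y /existsP[z /and3P[xy yz xz]]]]|no_tri] :=
  boolP [exists x, exists y, exists z, [&& e x y, e y z & e x z]].
  by exists x, y, z.
have e_tri x y z : e x y -> e y z -> ~~ e x z.
  move=> xy yz; apply: contra no_tri => xz.
  by apply/existsP; exists x; apply/existsP; exists y; apply/existsP; exists z;
     rewrite xy yz.
have /andP[al _] := halpha.
have aN0 : 0 <= alpha * #|T|%:R.
  by rewrite mulr_ge0 ?ler0n //; apply: le_trans al; rewrite divr_ge0 ?ler0n.
have [k kE] : exists k : nat, k%:Z = Num.floor (alpha * #|T|%:R).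
  by exists `|Num.floor (alpha * #|T|%:R)|%N; rewrite gez0_abs // floor_ge0.
have k_le : k%:R <= alpha * #|T|%:R :> R.
  by have := floor_le (alpha * #|T|%:R); rewrite -kE.
case: (not_locally_dense e_sym e_tri T_gt0 (R := R)).
apply: (locally_dense_of_sets e_sym e_irr e_tri T_gt0 halpha hbeta k_le) => S Sk.
by apply: sets_dense; rewrite Sk.
Qed.
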